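(* Let $(P,\le_P)$ be a finite partial order. Then there are finite undirected graphs $G_p$, $p\in P$, such that for all $p,q\in P$, $$p\le_P q\quad\Longleftrightarrow\quad G_p\to_q G_q.$$ Consequently, the quantum homomorphism order of finite graphs contains antichains of arbitrary finite size, chains of arbitrary finite length, and induced copies of every finite partial order. Moreover, the representation may be chosen explicitly as follows: choose pairwise distinct primes $\pi_r$, one for each $r\in P$, put $N_p=\prod_{r:\,p\le_P r}\pi_r$ for $p\in P$, and set $G_p=\overrightarrow{C}_{N_p}*J$, where $J=J(a,b)$ is the fixed ordered indicator defined in the context.
   Context: All graphs and digraphs are finite and loopless; undirected graphs are simple; directed graphs have no parallel arcs (opposite arcs are allowed). Quantum homomorphism. For finite undirected graphs $X,Y$, a quantum homomorphism from $X$ to $Y$ is a family of orthogonal projections $\{E_{x,y}: x\in V(X), y\in V(Y)\}$ on a nonzero finite-dimensional Hilbert space with identity $I$ such that: $\sum_{y\in V(Y)}E_{x,y}=I$ for every $x$; $E_{x,y}E_{x,y'}=0$ whenever $y\ne y'$; and $E_{x,y}E_{x',y'}=0$ whenever $xx'\in E(X)$ and $yy'\notin E(Y)$. Write $X\to_q Y$ if such a family exists. The relation $\to_q$ is reflexive and transitive; the quantum homomorphism order is the induced partial order on classes of the equivalence $G\equiv_q H\iff (G\to_q H\text{ and }H\to_q G)$. Directed cycles. $\overrightarrow{C}_n$ ($n\ge 2$) is the clockwise directed cycle on $n$ vertices, with arcs $i\to i+1 \pmod n$. Gadgets. All private vertices of a gadget are fresh (belonging to that gadget only), and no edges are added other than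 those listed. - $A$ gadget attached at a vertex $\alpha$ (then $\alpha$ is called an $A$-root): add private vertices $c_0,\dots,c_4$ forming a $5$-cycle $c_0c_1c_2c_3c_4c_0$, and make $\alpha$ adjacent to every $c_i$. - $B$ gadget attached at $\beta$ (then $\beta$ is a $B$-root): add two private vertices $\alpha_1,\alpha_2$, the edges $\beta\alpha_1,\beta\alpha_2,\alpha_1\alpha_2$, and attach a private $A$ gadget at each of $\alpha_1,\alpha_2$. - $E$ gadget attached at $\epsilon$ (then $\epsilon$ is an $E$-root): add two private vertices $\beta_1,\beta_2$, the edges $\epsilon\beta_1,\epsilon\beta_2,\beta_1\beta_2$, and attach a private $B$ gadget at each of $\beta_1,\beta_2$. Indicator $J=J(a,b)$. Start with a path $x_0-x_1-x_2-x_3-x_4-x_5-x_6$ (the spine), with ordered terminals $a=x_0$, $b=x_6$. Attach an $E$ gadget at each of $x_0,x_6$; an $A$ gadget at each of $x_1,x_2,x_5$; a $B$ gadget at each of $x_3,x_4$. No further edges. Replacement. For a loopless directed graph $H$, the undirected graph $H*J$ is obtained by taking, for every arc $u\to v$ of $H$, a fresh copy $J_{uv}$ of $J$ and identifying its terminal $a$ with $u$ and its terminal $b$ with $v$; all nonterminal vertices of the copies are kept distinct; isolated vertices of $H$ remain isolated vertices of $H*J$. *)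

(* Defs.v *)
From mathcomp Require Import all_boot all_order all_algebra.
From mathcomp Require Import sesquilinear spectral.
From mathcomp Require Import boolp reals.
From mathcomp.real_closed Require Import complex mxtens.

Set Implicit Arguments.
Unset Strict Implicit.
Unset Printing Implicit Defensive.

Import Order.TTheory GRing.Theory Num.Theory.
Local Open Scope ring_scope.
Local Open Scope sesquilinear_scope.

Record sgraph : Type := SGraph {
  vertex :> finType;
  adj : rel vertex;
  adj_sym : symmetric adj;
  adj_irr : irreflexive adj }.

Record digraph : Type := Digraph {
  dvertex :> finType;
  arc : rel dvertex;
  arc_irr : irreflexive arc }.

(* A nonzero finite-dimensional Hilbert space is taken
   to be the standard space C^n with 0 < n, where C = R[i]. *)

Definition orthoproj (R : realType) n (E : 'M[R[i]]_n) : Prop :=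
  E *m E = E /\ E ^t* = E.

Definition quantum_hom (R : realType) n (X Y : sgraph)
    (E : X -> Y -> 'M[R[i]]_n) : Prop :=
  [/\ forall x y, orthoproj (E x y),
      forall x, \sum_y E x y = 1%:M,
      forall x y y', y != y' -> E x y *m E x y' = 0
    & forall x x' y y', adj x x' -> ~~ adj y y' -> E x y *m E x' y' = 0].

Definition qhom (R : realType) (X Y : sgraph) : Prop :=
  exists n (E : X -> Y -> 'M[R[i]]_n), (0 < n)%N /\ quantum_hom E.

Lemma qhom_refl (R : realType) (X : sgraph) : qhom R X X.
Proof.
exists 1%N, (fun x y => (x == y)%:R%:M); split=> //; split.
- move=> x y; split; first by rewrite -scalar_mxM -natrM mulnb andbb.
  by rewrite tr_scalar_mx map_scalar_mx /= conjC_nat.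
- move=> x; rewrite (bigD1 x) //= eqxx big1 ?addr0 // => y.
  by rewrite eq_sym => /negPf ->; rewrite -scalemx1 scale0r.
- move=> x y y' neq; rewrite -scalar_mxM -natrM mulnb.
  by case: eqP => [->|] /=; rewrite ?(negPf neq) -scalemx1 scale0r.
- move=> x x' y y' xx' yy'; rewrite -scalar_mxM -natrM mulnb.
  have [e|_] /= := eqVneq x y; last by rewrite -scalemx1 scale0r.
  have [e'|_] := eqVneq x' y'; last by rewrite -scalemx1 scale0r.
  by rewrite -e -e' xx' in yy'.
Qed.

Lemma qhom_trans (R : realType) (X Y Z : sgraph) :
  qhom R X Y -> qhom R Y Z -> qhom R X Z.
Proof.
move=> [m [E [m0 [Ep E1 Eo Ea]]]] [n [F [n0 [Fp F1 Fo Fa]]]].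
exists (m * n)%N, (fun x z => \sum_y (E x y *t F y z)).
split; first by rewrite muln_gt0 m0.
have suml k l (I : finType) (f : I -> 'M[R[i]]_k) (A : 'M_l) :
    \sum_i (f i *t A) = (\sum_i f i) *t A.
  apply/matrixP=> i j; rewrite summxE mxE summxE mulr_suml.
  by apply: eq_bigr => t _; rewrite mxE.
have sumr k l (I : finType) (f : I -> 'M[R[i]]_k) (A : 'M_l) :
    \sum_i (A *t f i) = A *t (\sum_i f i).
  apply/matrixP=> i j; rewrite summxE mxE summxE mulr_sumr.
  by apply: eq_bigr => t _; rewrite mxE.
have prod x z x' z' : (\sum_y (E x y *t F y z)) *m (\sum_y (E x' y *t F y z'))
    = \sum_y \sum_y' ((E x y *m E x' y') *t (F y z *m F y' z')).
  rewrite mulmx_suml; apply: eq_bigr => y _; rewrite mulmx_sumr.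
  by apply: eq_bigr => y' _; rewrite tensmx_mul.
have prodx x z z' : (\sum_y (E x y *t F y z)) *m (\sum_y (E x y *t F y z'))
    = \sum_y (E x y *t (F y z *m F y z')).
  rewrite prod; apply: eq_bigr => y _; rewrite (bigD1 y) //= (Ep x y).1.
  rewrite big1 ?addr0 // => y'; rewrite eq_sym => yy'.
  by rewrite (Eo _ _ _ yy') tens0mx.
split.
- move=> x z; split.
    by rewrite prodx; apply: eq_bigr => y _; rewrite (Fp y z).1.
  rewrite linear_sum /= raddf_sum; apply: eq_bigr => y _ /=.
  by rewrite trmx_tens map_mxT (Ep x y).2 (Fp y z).2.
- move=> x; rewrite exchange_big /=.
  under eq_bigr => y _ do rewrite sumr F1.
  rewrite suml E1; apply/matrixP=> i j.
  case: (mxtens_indexP i) => i1 i2; case: (mxtens_indexP j) => j1 j2.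
  rewrite tensmxE !mxE -natrM mulnb.
  by rewrite (can_eq (@mxtens_indexK _ _)) xpair_eqE.
- move=> x z z' zz'; rewrite prodx big1 // => y _.
  by rewrite (Fo _ _ _ zz') tensmx0.
- move=> x x' z z' xx' zz'; rewrite prod big1 // => y _; rewrite big1 // => y' _.
  have [yy'|yy'] := boolP (adj y y'); first by rewrite (Fa _ _ _ _ yy' zz') tensmx0.
  by rewrite (Ea _ _ _ _ xx' yy') tens0mx.
Qed.

(* Equivalence classes are sets of graphs rather than an
   eq_quot: sgraph quantifies over finType, so it is too large a type to be a
   choiceType itself. *)

Definition qequiv (R : realType) (G H : sgraph) : Prop :=
  qhom R G H /\ qhom R H G.

Lemma qequiv_refl (R : realType) (G : sgraph) : qequiv R G G.
Proof. by split; apply: qhom_refl. Qed.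

Lemma qequiv_sym (R : realType) (G H : sgraph) : qequiv R G H -> qequiv R H G.
Proof. by case. Qed.

Lemma qequiv_trans (R : realType) (G H K : sgraph) :
  qequiv R G H -> qequiv R H K -> qequiv R G K.
Proof.
move=> [GH HG] [HK KH].
by split; [apply: qhom_trans HK | apply: qhom_trans HG].
Qed.

Definition qclass (R : realType) : Type :=
  {A : sgraph -> Prop | exists G, A = qequiv R G}.

Definition qclass_of (R : realType) (G : sgraph) : qclass R :=
  exist _ (qequiv R G) (ex_intro _ G erefl).

Definition qle (R : realType) (A B : qclass R) : Prop :=
  exists G H, [/\ sval A G, sval B H & qhom R G H].

Definition qlt (R : realType) (A B : qclass R) : Prop := qle A B /\ A <> B.

Lemma qclass_inj (R : realType) (A B : qclass R) : sval A = sval B -> A = B.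
Proof.
case: A B => [A pA] [B pB] /= e; case: _ / e pB => pB.
by rewrite (Prop_irrelevance pA pB).
Qed.

Lemma qclassP (R : realType) (A : qclass R) : exists G, A = qclass_of R G.
Proof. by have [G e] := svalP A; exists G; apply: qclass_inj. Qed.

Lemma qclass_ofP (R : realType) (G H : sgraph) :
  qclass_of R G = qclass_of R H <-> qequiv R G H.
Proof.
split=> [[e]|GH]; first by rewrite e; apply: qequiv_refl.
apply: qclass_inj; apply: funext => K; apply: propext.
by split; apply: qequiv_trans; [apply: qequiv_sym|].
Qed.

Lemma qle_class (R : realType) (G H : sgraph) :
  qle (qclass_of R G) (qclass_of R H) <-> qhom R G H.
Proof.
split=> [[G' [H' [/= [GG' _] [_ H'H] G'H']]]|GH].
  by apply: qhom_trans H'H; apply: qhom_trans G'H'.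
by exists G, H; split=> //; apply: qequiv_refl.
Qed.

Lemma qle_refl (R : realType) (A : qclass R) : qle A A.
Proof. by have [G ->] := qclassP A; apply/qle_class/qhom_refl. Qed.

Lemma qle_anti (R : realType) (A B : qclass R) : qle A B -> qle B A -> A = B.
Proof.
have [G ->] := qclassP A; have [H ->] := qclassP B.
by move=> /qle_class GH /qle_class HG; apply/qclass_ofP.
Qed.

Lemma qle_trans (R : realType) (A B C : qclass R) :
  qle A B -> qle B C -> qle A C.
Proof.
have [G ->] := qclassP A; have [H ->] := qclassP B; have [K ->] := qclassP C.
by move=> /qle_class GH /qle_class HK; apply/qle_class; apply: qhom_trans HK.
Qed.

Lemma complete_sym n : symmetric (fun i j : 'I_n => i != j).
Proof. by move=> i j; rewrite eq_sym. Qed.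

Lemma complete_irr n : irreflexive (fun i j : 'I_n => i != j).
Proof. by move=> i; rewrite eqxx. Qed.

Definition complete n : sgraph := SGraph (@complete_sym n) (@complete_irr n).

Definition path_adj n : rel 'I_n :=
  fun i j => (j == i.+1 :> nat) || (i == j.+1 :> nat).

Lemma path_sym n : symmetric (@path_adj n).
Proof. by move=> i j; rewrite /path_adj orbC. Qed.

Lemma path_irr n : irreflexive (@path_adj n).
Proof. by move=> i; rewrite /path_adj orbb; elim: (i : nat). Qed.

Definition path_graph n : sgraph := SGraph (@path_sym n) (@path_irr n).

(* 'Z_n is Z/nZ only for n >= 2; the graphs cycle_graph n and dcycle n below are used
   only for such n. *)

Definition cycle_adj n : rel 'Z_n := fun i j => (j == i + 1) || (i == j + 1).

Lemma cycle_sym n : symmetric (@cycle_adj n).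
Proof. by move=> i j; rewrite /cycle_adj orbC. Qed.

Lemma cycle_irr n : irreflexive (@cycle_adj n).
Proof.
by move=> i; rewrite /cycle_adj orbb eq_sym -subr_eq0 addrAC subrr add0r oner_eq0.
Qed.

Definition cycle_graph n : sgraph := SGraph (@cycle_sym n) (@cycle_irr n).

Definition dcycle_arc n : rel 'Z_n := fun i j => j == i + 1.

Lemma dcycle_irr n : irreflexive (@dcycle_arc n).
Proof.
by move=> i; rewrite /dcycle_arc eq_sym -subr_eq0 addrAC subrr add0r oner_eq0.
Qed.

Definition dcycle n : digraph := Digraph (@dcycle_irr n).

(* A gadget is given without its root: the graph induced on its private
   vertices, together with the private vertices adjacent to the root. *)
Record gadget : Type := Gadget { private :> sgraph; hooks : pred private }.

(* attach g is G with a private copy of the gadget g v attached at every vertex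
   v of G. *)
Section Attach.
Variables (G : sgraph) (g : G -> gadget).

Definition attach_vertex : Type := (G + {v : G & g v})%type.

Definition attach_adj (u w : attach_vertex) : bool :=
  match u, w with
  | inl u, inl w => adj u w
  | inl v, inr k | inr k, inl v => (tag k == v) && @hooks (g (tag k)) (tagged k)
  | inr k, inr l => (tag k == tag l) && adj (tagged k) (tagged_as k l)
  end.

Lemma attach_sym : symmetric attach_adj.
Proof.
move=> [u|[v k]] [w|[v' k']] //=; first exact: adj_sym.
have [e|ne] := eqVneq v v'; last by [].
by case: _ / e k' => k'; rewrite !tagged_asE adj_sym.
Qed.

Lemma attach_irr : irreflexive attach_adj.
Proof. by move=> [u|[v k]] /=; rewrite ?tagged_asE ?adj_irr ?andbF. Qed.

Definition attach : sgraph := @SGraph attach_vertex _ attach_sym attach_irr.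

Definition is_base (u : attach) : bool := if u is inl _ then true else false.

End Attach.

Definition A_gadget : gadget :=
  @Gadget (cycle_graph 5) (fun _ => true).

Definition B_gadget : gadget :=
  @Gadget (attach (fun _ : complete 2 => A_gadget)) (@is_base _ _).

Definition E_gadget : gadget :=
  @Gadget (attach (fun _ : complete 2 => B_gadget)) (@is_base _ _).

Record indicator : Type := Indicator {
  ind_graph :> sgraph;
  ind_a : ind_graph;
  ind_b : ind_graph;
  ind_neq : ind_a != ind_b }.

Definition J_gadget (i : path_graph 7) : gadget :=
  nth A_gadget [:: E_gadget; A_gadget; A_gadget; B_gadget; B_gadget;
                   A_gadget; E_gadget] i.

Definition J_graph : sgraph := attach J_gadget.

Definition J_spine (i : 'I_7) : J_graph := inl i.

Lemma J_neq : J_spine ord0 != J_spine ord_max.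
Proof. by []. Qed.

Definition J : indicator := Indicator J_neq.

Section Replacement.
Variables (H : digraph) (I : indicator).

Definition arcs : finType := {e : H * H | arc e.1 e.2}.

Definition nonterminals : finType := {x : I | (x != ind_a I) && (x != ind_b I)}.

Definition repl_vertex : finType := (H + arcs * nonterminals)%type.

(* The vertex of H * I that comes from the vertex x of the copy of I at e *)
Definition repl_copy (e : arcs) (x : I) : repl_vertex :=
  if insub x is Some z then inr (e, z)
  else inl (if x == ind_a I then (val e).1 else (val e).2).

Definition repl_adj (u w : repl_vertex) : bool :=
  [exists e, exists x, exists y,
    [&& adj x y, repl_copy e x == u & repl_copy e y == w]].

Lemma repl_copy_inj e : injective (repl_copy e).
Proof.
have ne : (val e).1 != (val e).2.
  by apply/eqP=> eq; have := valP e; rewrite /= -eq arc_irr.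
move=> x y; rewrite /repl_copy.
case: insubP => [z _ <-|]; case: insubP => [z' _ <-|] //.
  by move=> [->].
rewrite !negb_and !negbK => ty tx [].
have [->|xa] := eqVneq x (ind_a I); have [->|ya] := eqVneq y (ind_a I) => //.
- by move/eqP; rewrite (negPf ne).
- by move/eqP; rewrite eq_sym (negPf ne).
by move=> _; move: tx ty; rewrite (negPf xa) (negPf ya) => /eqP-> /eqP->.
Qed.

Lemma repl_adjP u w :
  reflect (exists e x y, [/\ adj x y, repl_copy e x = u & repl_copy e y = w])
          (repl_adj u w).
Proof.
apply: (iffP existsP) => [[e /existsP[x /existsP[y /and3P[xy /eqP xu /eqP yw]]]]|].
  by exists e, x, y.
move=> [e [x [y [xy <- <-]]]]; exists e; apply/existsP; exists x.
by apply/existsP; exists y; rewrite xy !eqxx.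
Qed.

Lemma repl_sym : symmetric repl_adj.
Proof.
by move=> u w; apply/idP/idP=> /repl_adjP[e [x [y [xy xu yw]]]];
  apply/repl_adjP; exists e, y, x; rewrite adj_sym.
Qed.

Lemma repl_irr : irreflexive repl_adj.
Proof.
move=> u; apply/negbTE/negP=> /repl_adjP[e [x [y [xy <- /repl_copy_inj eq]]]].
by rewrite eq adj_irr in xy.
Qed.

Definition replacement : sgraph := SGraph repl_sym repl_irr.

End Replacement.

(* Main.v *)
Require Import Defs.
From mathcomp Require Import all_boot all_order all_algebra.
From mathcomp Require Import sesquilinear spectral.
From mathcomp Require Import reals.
From mathcomp.real_closed Require Import complex.

(** Divisibility carries the order.  A prime divides [N_p] iff it is attached to
    some [r >= p], so [N_q] divides [N_p] iff [p <= q]; it remains to see that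
    for [n, m >= 2] there is a quantum homomorphism from [C_n * J] to [C_m * J]
    iff [m] divides [n] ([dcycle_qhomP]).  If [m] divides [n], reduction modulo
    [m] is an ordinary homomorphism of directed cycles, which extends over the
    copies of [J].

    The converse rests on the gadgets being rigid even for quantum maps.  Write
    [E x y] for the projections.

    - The root [x] of an [A] gadget is the hub of a wheel with an odd rim.  If
      the neighbourhood of [y] is bipartite, the two sides split the range of
      [E x y], and going one step along the rim exchanges the two parts; after
      five steps each part is equal to the other, to which it is orthogonal, so
      [E x y = 0] ([wheel_hub_vanish]).
    - The root [x] of a [B] gadget has two adjacent neighbours that can only be
      sent to vertices with non-bipartite neighbourhood.  If no two such
      vertices near [y] are adjacent, then [E x y = 0]
      ([edge_roots_vanish]).  The same argument, one level up, treats [E].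

    In [K * J] the vertices with non-bipartite neighbourhood are the intended
    [A]-roots, hence the vertices with two adjacent [A]-roots among their
    neighbours are the intended [B]-roots, and so on: the [E]-roots are vertices
    of [K].  All these conditions are local and pull back along homomorphisms,
    so they are verified once, in a graph of 22 labels onto which every [K * J]
    folds.  The spine of [J] has types [E A A B B A E], and a walk of these
    types in [K * J] has to follow the spine of one copy of [J], from its
    terminal [a] to its terminal [b] ([typed_walk_arc]).  Hence, for an arc
    [u -> v], the product of [E u y] and [E v y'] vanishes unless [y -> y'] is
    an arc ([base_orth]).

    On directed cycles every vertex has one successor, so this forces
    [E u y = E (u+1) (y+1)].  After [n] steps [E 0 y = E 0 (y+n)], and when [m]
    does not divide [n] these two projections are orthogonal, so all the
    [E 0 y] vanish although they sum to the identity. *)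

Set Implicit Arguments.
Unset Strict Implicit.
Unset Printing Implicit Defensive.

Import Order.TTheory GRing.Theory Num.Theory.

(** * Homomorphisms and attached gadgets *)

Section Homs.
Local Open Scope ring_scope.

(** The target is a bare relation because the labels onto which replacements
    are folded are an inductive type with no finite-type structure. *)
Definition hom (X : sgraph) (T : Type) (r : rel T) (f : X -> T) : Prop :=
  forall x x', adj x x' -> r (f x) (f x').

Lemma hom_qhom (R : realType) (X Y : sgraph) (f : X -> Y) :
  hom (@adj Y) f -> qhom R X Y.
Proof.
move=> fhom; exists 1%N, (fun x y => (f x == y)%:R%:M); split=> //; split.
- move=> x y; split; first by rewrite -scalar_mxM -natrM mulnb andbb.
  by rewrite tr_scalar_mx map_scalar_mx /= conjC_nat.
- move=> x; rewrite (bigD1 (f x)) //= eqxx big1 ?addr0 // => y.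
  by rewrite eq_sym => /negPf ->; rewrite -scalemx1 scale0r.
- move=> x y y' ne; rewrite -scalar_mxM -natrM mulnb.
  by case: eqP => [->|] /=; rewrite ?(negPf ne) -scalemx1 scale0r.
- move=> x x' y y' /fhom xx' yy'; rewrite -scalar_mxM -natrM mulnb.
  have [e|_] /= := eqVneq (f x) y; last by rewrite -scalemx1 scale0r.
  have [e'|_] := eqVneq (f x') y'; last by rewrite -scalemx1 scale0r.
  by rewrite -e -e' xx' in yy'.
Qed.

(** A homomorphic image of the gadget off [x], rather than an induced copy with
    private vertices: this is all that the rigidity arguments use of a root, and
    it is preserved by homomorphisms. *)
Definition hangs (g : gadget) (T : Type) (r : rel T) (x : T) : Prop :=
  exists c : g -> T, hom r c /\ forall k, hooks k -> r x (c k).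

Lemma hangs_hom (g : gadget) (G : sgraph) (T : Type) (r : rel T)
    (f : G -> T) x : hom r f -> hangs g (@adj G) x -> hangs g r (f x).
Proof.
move=> fhom [c [chom chook]]; exists (f \o c); split.
  by move=> k l /chom /fhom.
by move=> k /chook /fhom.
Qed.

Lemma hangs_attach (G : sgraph) (g : G -> gadget) (v : G) :
  hangs (g v) (@adj (attach g)) (inl v).
Proof.
exists (fun k => inr (Tagged (fun w => g w) k)); split=> [k l kl|k hk] /=.
  by rewrite eqxx tagged_asE.
by rewrite eqxx.
Qed.

Lemma attach_hom (G : sgraph) (T : Type) (r : rel T) (g : G -> gadget)
    (f : G -> T) (c : forall v, g v -> T) :
  symmetric r -> hom r f -> (forall v, hom r (c v)) ->
  (forall v k, hooks k -> r (f v) (c v k)) ->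
  hom r (fun u : attach g =>
           match u with inl v => f v | inr k => c (tag k) (tagged k) end).
Proof.
move=> rsym fhom chom fc [u|[v k]] [w|[v' k']] /=.
- exact: fhom.
- by move=> /andP[/eqP <-]; apply: fc.
- by rewrite rsym => /andP[/eqP <-]; apply: fc.
- move=> /andP[/eqP e]; case: _ / e k' => k'; rewrite tagged_asE; exact: chom.
Qed.

End Homs.

(** * Rigidity of wheels and triangles under quantum homomorphisms *)

Section Quantum.
Local Open Scope ring_scope.
Local Open Scope sesquilinear_scope.

Lemma mulmx_adj_eq0 (C : numClosedFieldType) m p (A : 'M[C]_(m, p)) :
  A *m A^t* = 0 -> A = 0.
Proof.
move=> AA; apply/matrixP=> i j; rewrite mxE.
have /psumr_eq0P z : \sum_k A i k * (A i k)^* = 0.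
  transitivity ((A *m A^t*) i i); last by rewrite AA mxE.
  by rewrite mxE; apply: eq_bigr => k _; rewrite !mxE.
have /eqP := z (fun k _ => mul_conjC_ge0 _) j isT.
by rewrite mul_conjC_eq0 => /eqP.
Qed.

Variables (R : realType) (n : nat) (X Y : sgraph) (E : X -> Y -> 'M[R[i]]_n).
Hypothesis qE : quantum_hom E.

(** The projection onto the event that [x] is sent into [Q]. *)
Definition proj (x : X) (Q : pred Y) : 'M[R[i]]_n := \sum_(z | Q z) E x z.

Lemma proj_mul x Q Q' : proj x Q *m proj x Q' = proj x (predI Q Q').
Proof.
have [Ep _ Eo _] := qE; rewrite /proj mulmx_suml [RHS]big_mkcond /= big_mkcond.
apply: eq_bigr => z _; case: (Q z) => //=.
rewrite mulmx_sumr; case: ifP => Qz.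
  rewrite (bigD1 z) //= (Ep x z).1 big1 ?addr0 // => z' /andP[_].
  by rewrite eq_sym; apply: Eo.
rewrite big1 // => z' Qz'; apply: Eo.
by apply: contraTneq Qz' => <-; rewrite Qz.
Qed.

Lemma proj_adjoint x Q : (proj x Q)^t* = proj x Q.
Proof.
have [Ep _ _ _] := qE; rewrite /proj linear_sum /= raddf_sum.
by apply: eq_bigr => z _ /=; rewrite (Ep x z).2.
Qed.

Lemma proj_orth x x' (Q Q' : pred Y) : adj x x' ->
  (forall z z', Q z -> Q' z' -> ~~ adj z z') -> proj x Q *m proj x' Q' = 0.
Proof.
have [_ _ _ Ea] := qE; move=> xx' QQ'; rewrite mulmx_suml big1 // => z Qz.
by rewrite mulmx_sumr big1 // => z' Qz'; apply: Ea (QQ' _ _ _ _).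
Qed.

Lemma proj_id x (Q : pred Y) k (M : 'M[R[i]]_(k, n)) :
  (forall z, ~~ Q z -> M *m E x z = 0) -> M *m proj x Q = M.
Proof.
have [_ E1 _ _] := qE; move=> h; rewrite -[RHS]mulmx1 -(E1 x) (bigID Q) /=.
by rewrite mulmxDr [X in _ + X]mulmx_sumr [X in _ + X]big1 ?addr0.
Qed.

(** The projections of adjacent vertices need not commute; that the range of
    [E x y] lies in that of the neighbourhood projection is what replaces
    restricting the neighbours of [x] to the event that [x] is sent to [y]. *)
Lemma proj_nbr x x' y : adj x x' -> E x y *m proj x' (adj y) = E x y.
Proof.
by have [_ _ _ Ea] := qE; move=> xx'; apply: proj_id => z; apply: Ea.
Qed.

Definition confined (x : X) (Q : pred Y) : Prop :=
  forall z, ~~ Q z -> E x z = 0.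

Lemma proj_nbr_in x x' y Q : adj x x' -> confined x' Q ->
  E x y *m proj x' (predI (adj y) Q) = E x y.
Proof.
move=> xx' aQ; rewrite -proj_mul mulmxA proj_nbr //.
by apply: proj_id => z /aQ ->; rewrite mulmx0.
Qed.

(** On the range of [E x y] both [x1] and [x2] are sent to neighbours of [y]
    that satisfy [Q], and the projections onto these two events are orthogonal
    when these neighbours are pairwise non-adjacent. *)
Lemma edge_roots_vanish x x1 x2 y Q : adj x x1 -> adj x x2 -> adj x1 x2 ->
  confined x1 Q -> confined x2 Q ->
  (forall z z', adj y z -> adj y z' -> Q z -> Q z' -> ~~ adj z z') ->
  E x y = 0.
Proof.
move=> xx1 xx2 x12 a1 a2 ind.
rewrite -(proj_nbr_in y xx2 a2) -(proj_nbr_in y xx1 a1) -mulmxA.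
rewrite proj_orth ?mulmx0 // => z z' /andP[yz Qz] /andP[yz' Qz'].
exact: ind.
Qed.

(** One step of expanding [E x y *m N] over the walks that start at [y] in the
    target; iterating it along a path of the source reduces the vanishing of a
    product of two distant projections to the absence of typed walks. *)
Lemma walk_step x x' y Q k (N : 'M[R[i]]_(n, k)) : adj x x' -> confined x' Q ->
  (forall y', adj y y' -> Q y' -> E x' y' *m N = 0) -> E x y *m N = 0.
Proof.
move=> xx' aQ h; rewrite -(proj_nbr_in y xx' aQ) -mulmxA /proj mulmx_suml.
by rewrite big1 ?mulmx0 // => y' /andP[]; apply: h.
Qed.

Section Wheel.
Variables (x : X) (y : Y) (c : 'Z_5 -> X) (side : pred Y).
Hypothesis hub : forall i, adj x (c i).
Hypothesis rim : forall i, adj (c i) (c (i + 1)).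
Hypothesis bip : forall z z', adj y z -> adj y z' -> adj z z' ->
  side z != side z'.

(* The event that the rim vertex [i] is sent to the neighbours of [y] on side
   [b]. *)
Let P b i := proj (c i) (predI (adj y) (fun z => side z == b)).

Let P_total b i : E x y *m P b i + E x y *m P (~~ b) i = E x y.
Proof.
rewrite -[RHS](proj_nbr y (hub i)) -mulmxDr; congr (_ *m _).
rewrite /P /proj [RHS](bigID (fun z => side z == b)) /=; congr (_ + _).
by apply: eq_bigl => z; case: (side z) b => [] [].
Qed.

Let P_same b i : P b i *m P b (i + 1) = 0.
Proof.
apply: proj_orth => // z z' /andP[yz /eqP sz] /andP[yz' /eqP sz'].
by apply/negP => /(bip yz yz'); rewrite sz sz' eqxx.
Qed.

Let P_same' b i : P b (i + 1) *m P b i = 0.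
Proof.
have := congr1 (fun M : 'M_n => M^t*) (P_same b i).
by rewrite trmx_mul map_mxM /= !proj_adjoint trmx0 map_mx0.
Qed.

Let P_idem b i : P b i *m P b i = P b i.
Proof. by rewrite proj_mul; apply: eq_bigl => z /=; rewrite andbb. Qed.

Let P_opp b i : P b i *m P (~~ b) i = 0.
Proof.
rewrite proj_mul /proj big_pred0 // => z /=.
by case: (adj y z) (side z) b => [] [] [].
Qed.

(* Consecutive rim vertices are sent to opposite sides.  With [F = E x y], and
   [A] and [B] the two projections to compare, [F *m A = F *m B *m A] and
    [F *m B = F *m A *m B]. *)
Let P_step b i : E x y *m P b i = E x y *m P (~~ b) (i + 1).
Proof.
have [Ep _ _ _] := qE; have [_ Fs] := Ep x y.
set F := E x y in Fs *; set A := P b i; set B := P (~~ b) (i + 1).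
have FB : F *m B = F *m A *m B.
  rewrite -{1}[F](P_total b i) mulmxDl -/F -/A.
  by rewrite -[_ *m P (~~ b) i *m B]mulmxA P_same mulmx0 addr0.
have FA : F *m A = F *m B *m A.
  rewrite -{1}[F](P_total b (i + 1)) mulmxDl -/F -/B.
  by rewrite -[F *m P b (i + 1) *m A]mulmxA P_same' mulmx0 add0r.
(* The difference is [F *m (A - B)], and already [F *m (A - B) *m (A - B)] is 0,
   so that its product with its adjoint vanishes. *)
apply/eqP; rewrite -subr_eq0; apply/eqP/mulmx_adj_eq0.
have adjAB : (A - B)^t* = A - B.
  by rewrite linearB /= raddfB /= !proj_adjoint.
rewrite -mulmxBr trmx_mul map_mxM /= Fs adjAB.
suff -> : F *m (A - B) *m ((A - B) *m F) = F *m ((A - B) *m (A - B)) *m F.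
  suff -> : F *m ((A - B) *m (A - B)) = 0 by rewrite mul0mx.
  rewrite mulmxA !mulmxBr !mulmxBl -FB -FA -!mulmxA !P_idem.
  by rewrite (subrr (F *m A)) (subrr (F *m B)) subr0.
by rewrite !mulmxA.
Qed.

Lemma wheel_hub_vanish : E x y = 0.
Proof.
have P0 b : E x y *m P b 0 = 0.
  have e : E x y *m P b 0 = E x y *m P (~~ b) 0.
    (* Five steps of the rim return to the start and, five being odd, exchange
       the sides. *)
    rewrite 5!P_step !negbK; congr (_ *m P _ _); exact: val_inj.
  by rewrite -P_idem mulmxA e -mulmxA -{2}[b]negbK P_opp mulmx0.
by rewrite -(P_total true 0) !P0 addr0.
Qed.

End Wheel.
End Quantum.

(** * The graph of labels *)

Section Labels.
Local Open Scope ring_scope.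

(** [Eps], [Beta] and [Alpha] label the roots of [E], [B] and [A] gadgets, the
    last two within the gadgets above them; [S1] to [S5] label the inner spine,
    and [Cyc] the 5-cycles.  All the gadgets of one kind are identified, except
    that [A]-roots, and likewise [B]-roots, get one of two colours so that
    adjacent roots keep distinct gadgets: [Alpha b j] is the [A]-root of colour
    [j] in the gadget of the [B]-roots of colour [b], and [Cyc j i] is the
    vertex [i] of the cycle of the [A]-roots of colour [j].  Without the colours
    the folding would create neighbourhoods of the wrong type. *)
Inductive label : Type :=
  | Eps | S1 | S2 | S3 | S4 | S5
  | Beta of bool
  | Alpha of bool & bool
  | Cyc of bool & 'Z_5.

Definition is_E (l : label) : bool := if l is Eps then true else false.

Definition B_colour (l : label) : option bool :=
  match l with
  | S3 => Some false | S4 => Some true | Beta b => Some b | _ => None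
  end.

Definition A_colour (l : label) : option bool :=
  match l with
  | S1 | S5 => Some false | S2 => Some true | Alpha _ j => Some j | _ => None
  end.

Definition is_B l : bool := B_colour l.
Definition is_A l : bool := A_colour l.

Definition label_edge (l m : label) : bool :=
  match l, m with
  | Eps, (S1 | S5 | Beta _) | S1, S2 | S2, S3 | S3, S4 | S4, S5 => true
  | Beta b, Beta b' => b != b'
  | Alpha b j, Alpha b' j' => (b == b') && (j != j')
  | _, Alpha b _ => B_colour l == Some b
  | Cyc j i, Cyc j' i' => (j == j') && cycle_adj i i'
  | _, Cyc j _ => A_colour l == Some j
  | _, _ => false
  end.

Definition label_adj (l m : label) : bool := label_edge l m || label_edge m l.

Lemma label_adj_sym : symmetric label_adj.
Proof. by move=> l m; rewrite /label_adj orbC. Qed.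

Lemma Z5_triangle_free (i j k : 'Z_5) :
  cycle_adj i j -> cycle_adj i k -> ~~ cycle_adj j k.
Proof.
by case: i => [[|[|[|[|[|i]]]]] ?] //; case: j => [[|[|[|[|[|j]]]]] ?] //;
  case: k => [[|[|[|[|[|k]]]]] ?].
Qed.

(** A 2-colouring of the neighbourhood of [y] when [y] is not an [A]-root. *)
Definition side (y z : label) : bool :=
  match y, z with
  | Cyc _ _, _ => is_A z
  | Eps, Beta b => b
  | _, Beta _ => true
  | _, Alpha _ j => j
  | _, _ => false
  end.

(** [A]-roots are the only labels that can have an odd cycle among their
    neighbours: on the neighbourhood of [Cyc j i], the only edges join an
    [A]-root to a vertex of the triangle-free 5-cycle. *)
Lemma label_bip y z z' : ~~ is_A y -> label_adj y z -> label_adj y z' ->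
  label_adj z z' -> side y z != side y z'.
Proof.
case: y => [||||||b|b j|j i] //; case: z => [||||||b1|b1 j1|j1 i1] //=;
  case: z' => [||||||b2|b2 j2|j2 i2] //=;
  rewrite /label_adj /label_edge /= ?orbF //.
all: try by repeat match goal with b : bool |- _ => destruct b end.
have E (a b : bool) (k l : 'Z_5) :
    (a == b) && cycle_adj k l || (b == a) && cycle_adj l k ->
    cycle_adj k l by case/orP=> /andP[_] //; rewrite cycle_sym.
by move=> _ /E ii1 /E ii2 /E i12; have /negP[] := Z5_triangle_free ii1 ii2.
Qed.

Lemma label_A_indep y z z' : ~~ is_B y -> label_adj y z -> label_adj y z' ->
  is_A z -> is_A z' -> ~~ label_adj z z'.
Proof.
case: y => [||||||b|b j|j i] //; case: z => [||||||b1|b1 j1|j1 i1] //=;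
  case: z' => [||||||b2|b2 j2|j2 i2] //=;
  rewrite /label_adj /label_edge /= ?orbF //.
all: by repeat match goal with b : bool |- _ => destruct b end.
Qed.

Lemma label_B_indep y z z' : ~~ is_E y -> label_adj y z -> label_adj y z' ->
  is_B z -> is_B z' -> ~~ label_adj z z'.
Proof.
case: y => [||||||b|b j|j i] //; case: z => [||||||b1|b1 j1|j1 i1] //=;
  case: z' => [||||||b2|b2 j2|j2 i2] //=;
  rewrite /label_adj /label_edge /= ?orbF //.
all: by repeat match goal with b : bool |- _ => destruct b end.
Qed.

(** The types determine the walk and its direction: [Eps] has the [A]-neighbours
    [S1] and [S5], of which only [S1] has an [A]-neighbour; and the detour
    from [S4] to the [A]-roots of its own gadget does not continue to [Eps]. *)
Lemma label_walk l0 l1 l2 l3 l4 l5 l6 :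
  is_E l0 -> label_adj l0 l1 -> is_A l1 -> label_adj l1 l2 -> is_A l2 ->
  label_adj l2 l3 -> is_B l3 -> label_adj l3 l4 -> is_B l4 ->
  label_adj l4 l5 -> is_A l5 -> label_adj l5 l6 -> is_E l6 ->
  [/\ l1 = S1, l2 = S2, l3 = S3, l4 = S4 & l5 = S5].
Proof.
case: l0 => // _ a01 A1 a12 A2 a23 B3 a34 B4 a45 A5 a56.
case: l6 a56 => // a56 _.
have [e1 e2] : l1 = S1 /\ l2 = S2.
  by case: l1 a01 A1 a12 => // _ _; case: l2 A2 {a23} => //.
subst l1 l2; have e3 : l3 = S3 by case: l3 a23 B3 {a34}.
subst l3; have e4 : l4 = S4 by case: l4 a34 B4 {a45}.
subst l4; have e5 : l5 = S5 by case: l5 a45 A5 a56.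
by subst l5.
Qed.

End Labels.

(** * Folding the indicator onto the labels *)

Section Labelling.
Local Open Scope ring_scope.

Definition bit (i : 'I_2) : bool := i == 1%N :> nat.

Definition label_A (j : bool) : A_gadget -> label := Cyc j.

Definition label_B (b : bool) (u : B_gadget) : label :=
  match u with
  | inl j => Alpha b (bit j)
  | inr k => label_A (bit (tag k)) (tagged k)
  end.

Definition label_E (u : E_gadget) : label :=
  match u with
  | inl b => Beta (bit b)
  | inr k => label_B (bit (tag k)) (tagged k)
  end.

Definition label_spine (i : nat) : label :=
  nth Eps [:: Eps; S1; S2; S3; S4; S5; Eps] i.

(** The matching is on a number because the gadget at [i] reduces only for a
    concrete [i].  The colours are those of the root at position [i]; beyond 6
    there is no spine vertex and the value is arbitrary. *)
Definition label_gadget (i : nat) :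
    nth A_gadget [:: E_gadget; A_gadget; A_gadget; B_gadget; B_gadget;
                     A_gadget; E_gadget] i -> label :=
  match i with
  | 0 => label_E
  | 1 => label_A false
  | 2 => label_A true
  | 3 => label_B false
  | 4 => label_B true
  | 5 => label_A false
  | 6 => label_E
  | _ => fun=> Eps
  end.

Definition label_J (u : J) : label :=
  match u with
  | inl i => label_spine i
  | inr k => label_gadget (tagged k)
  end.

Lemma bit_neq (i j : 'I_2) : i != j -> bit i != bit j.
Proof. by case: i j => [[|[|?]] ?] [[|[|?]] ?]. Qed.

Lemma label_A_hom j : hom label_adj (label_A j).
Proof. by move=> i i' ii'; apply/orP; left; rewrite /= eqxx. Qed.

Lemma label_A_root l j k : A_colour l = Some j -> label_adj l (label_A j k).
Proof.
by rewrite /label_adj; case: l => //= [|||b j'] [->]; rewrite ?eqxx.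
Qed.

Lemma label_B_hom b : hom label_adj (@label_B b).
Proof.
apply: (@attach_hom (complete 2) _ _ (fun=> A_gadget) (fun j => Alpha b (bit j))
                    (fun j => label_A (bit j))).
- exact: label_adj_sym.
- by move=> j j' /bit_neq jj'; rewrite /label_adj /= eqxx jj'.
- by move=> j; apply: label_A_hom.
- by move=> j k _; apply: label_A_root.
Qed.

Lemma label_B_root l b (k : B_gadget) :
  B_colour l = Some b -> hooks k -> label_adj l (label_B b k).
Proof.
case: k => [j|//] + _; rewrite /label_adj.
by case: l => //= [||b'] [->]; rewrite ?eqxx.
Qed.

Lemma label_E_hom : hom label_adj label_E.
Proof.
apply: (@attach_hom (complete 2) _ _ (fun=> B_gadget) (fun b => Beta (bit b))
                    (fun b => label_B (bit b))).
- exact: label_adj_sym.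
- by move=> b b' /bit_neq bb'; rewrite /label_adj /= bb'.
- by move=> b; apply: label_B_hom.
- by move=> b k; apply: label_B_root.
Qed.

Lemma label_J_hom : hom label_adj label_J.
Proof.
apply: (@attach_hom (path_graph 7) _ _ J_gadget (fun i => label_spine i)
                    (fun i => @label_gadget i)).
- exact: label_adj_sym.
- by move=> [[|[|[|[|[|[|[|?]]]]]]] ?] [[|[|[|[|[|[|[|?]]]]]]] ?].
- move=> [[|[|[|[|[|[|[|?]]]]]]] ?] //=;
  [exact: label_E_hom | exact: label_A_hom | exact: label_A_hom
  | exact: label_B_hom | exact: label_B_hom | exact: label_A_hom
  | exact: label_E_hom].
- move=> [[|[|[|[|[|[|[|?]]]]]]] ?] //= k;
  try (by move=> _; apply: label_A_root); try exact: label_B_root;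
  by case: k.
Qed.

Definition spine (i : nat) (i7 : (i < 7)%N) : J := J_spine (Ordinal i7).

Definition off_spine (l : label) : bool :=
  match l with Beta _ | Alpha _ _ | Cyc _ _ => true | _ => false end.

Lemma label_B_off b (u : B_gadget) : off_spine (label_B b u).
Proof. by case: u. Qed.

Lemma label_E_off (u : E_gadget) : off_spine (label_E u).
Proof. by case: u => [//|k]; apply: label_B_off. Qed.

(** Hence a spine label on a vertex of
    [J] identifies that vertex, up to exchanging the two terminals. *)
Lemma label_gadget_off i (i7 : (i < 7)%N) k : off_spine (@label_gadget i k).
Proof.
by move: k; case: i i7 => [|[|[|[|[|[|[|?]]]]]]] // _ k;
  first [exact: label_E_off | exact: label_B_off].
Qed.

Lemma label_J_E x : is_E (label_J x) -> (x == ind_a J) || (x == ind_b J).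
Proof.
case: x => [[i i7]|[[i i7] k]] /=.
  by case: i i7 => [|[|[|[|[|[|[|?]]]]]]] //.
by have := label_gadget_off i7 k; case: label_gadget.
Qed.

Lemma label_J_S1 x : label_J x = S1 -> x = spine (isT : 1 < 7)%N.
Proof.
case: x => [[i i7]|[[i i7] k]] /=.
  by case: i i7 => [|[|[|[|[|[|[|?]]]]]]] // ? _; congr inl; apply: val_inj.
by have := label_gadget_off i7 k; case: label_gadget.
Qed.

Lemma label_J_S5 x : label_J x = S5 -> x = spine (isT : 5 < 7)%N.
Proof.
case: x => [[i i7]|[[i i7] k]] /=.
  by case: i i7 => [|[|[|[|[|[|[|?]]]]]]] // ? _; congr inl; apply: val_inj.
by have := label_gadget_off i7 k; case: label_gadget.
Qed.

End Labelling.

(** * Homomorphisms out of a replacement *)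

Section Replacements.
Local Open Scope ring_scope.

Lemma repl_copy_hom (H : digraph) (I : indicator) (e : arcs H) :
  hom (@adj (replacement H I)) (@repl_copy H I e).
Proof. by move=> x y xy; apply/repl_adjP; exists e, x, y. Qed.

Lemma repl_copy_a (H : digraph) (I : indicator) (e : arcs H) :
  repl_copy e (ind_a I) = inl (val e).1.
Proof. by rewrite /repl_copy insubN ?eqxx. Qed.

Lemma repl_copy_b (H : digraph) (I : indicator) (e : arcs H) :
  repl_copy e (ind_b I) = inl (val e).2.
Proof.
by rewrite /repl_copy insubN ?eqxx ?andbF // eq_sym (negPf (ind_neq I)).
Qed.

Lemma repl_copyK (H : digraph) (I : indicator) (e : arcs H)
    (z : nonterminals I) : repl_copy e (val z) = inr (e, z).
Proof. by rewrite /repl_copy valK. Qed.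

Lemma repl_copy_inr (H : digraph) (I : indicator) (e e' : arcs H) x
    (z : nonterminals I) : repl_copy e x = inr (e', z) -> e = e' /\ x = val z.
Proof. by rewrite /repl_copy; case: insubP => // z' _ <- [-> ->]. Qed.

Lemma repl_copy_inl (H : digraph) (I : indicator) (e : arcs H) (x : I) u :
  repl_copy e x = inl u ->
  x = ind_a I /\ u = (val e).1 \/ x = ind_b I /\ u = (val e).2.
Proof.
rewrite /repl_copy; case: insubP => // tx [<-].
have [xa|xa] := eqVneq x (ind_a I); first by left.
by move: tx; rewrite xa /= negbK => /eqP; right.
Qed.

Lemma repl_adj_copy (H : digraph) (I : indicator) (e e' : arcs H)
    (z z' : nonterminals I) :
  adj (inr (e, z) : replacement H I) (inr (e', z')) -> e = e'.
Proof.
by move=> /repl_adjP[d [x [y [_ /repl_copy_inr[<- _] /repl_copy_inr[<- _]]]]].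
Qed.

Lemma repl_adj_base (H : digraph) (I : indicator) (u : H) (e : arcs H)
    (z : nonterminals I) :
  adj (inl u : replacement H I) (inr (e, z)) ->
  adj (ind_a I) (val z) /\ u = (val e).1 \/
  adj (ind_b I) (val z) /\ u = (val e).2.
Proof.
move=> /repl_adjP[d [x [y [xy /repl_copy_inl xu /repl_copy_inr[<- <-]]]]].
by case: xu => -[<- ->]; [left | right].
Qed.

(** The map that superposes all the copies of [I]. *)
Definition repl_fold (H : digraph) (I : indicator) (T : Type) (f : I -> T)
    (w : replacement H I) : T :=
  match w with inl _ => f (ind_a I) | inr (_, z) => f (val z) end.

Lemma repl_fold_hom (H : digraph) (I : indicator) (T : Type) (r : rel T)
    (f : I -> T) :
  f (ind_a I) = f (ind_b I) -> hom r f -> hom r (@repl_fold H I T f).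
Proof.
move=> fab fhom.
have fE e x : repl_fold f (repl_copy e x) = f x.
  case ux: (repl_copy e x) => [u|[e' z]] /=; last first.
    by have [_ ->] := repl_copy_inr ux.
  by have [[-> _]|[-> _]] := repl_copy_inl ux.
by move=> u w /repl_adjP[e [x [y [xy <- <-]]]]; rewrite !fE; apply: fhom.
Qed.

Lemma replacement_hom (H K : digraph) (I : indicator) (f : H -> K) :
  (forall u v, Defs.arc u v -> Defs.arc (f u) (f v)) ->
  exists F : replacement H I -> replacement K I, hom (@adj _) F.
Proof.
move=> farc.
have fe (e : arcs H) : Defs.arc (f (val e).1) (f (val e).2).
  exact: farc (valP e).
pose fa (e : arcs H) : arcs K := Sub (f (val e).1, f (val e).2) (fe e).
pose F (w : replacement H I) : replacement K I :=
  match w with inl u => inl (f u) | inr (e, z) => inr (fa e, z) end.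
exists F => u w /repl_adjP[e [x [y [xy <- <-]]]].
have FE t : F (repl_copy e t) = repl_copy (fa e) t.
  case ut: (repl_copy e t) => [v|[e' z]] /=; last first.
    by have [-> ->] := repl_copy_inr ut; rewrite repl_copyK.
  have [[-> ->]|[-> ->]] := repl_copy_inl ut; first by rewrite repl_copy_a.
  by rewrite repl_copy_b.
by rewrite !FE; apply: repl_copy_hom.
Qed.

End Replacements.

(** * Walks of the type of the spine *)

Section TypedWalk.
Local Open Scope ring_scope.
Variable K : digraph.
Implicit Types w : replacement K J.

Definition fold_label w : label := repl_fold label_J w.

Lemma fold_label_hom : hom label_adj fold_label.
Proof. by apply: repl_fold_hom => //; apply: label_J_hom. Qed.

Lemma fold_label_E w : is_E (fold_label w) -> exists u, w = inl u.
Proof.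
case: w => [u|[e z]]; first by exists u.
by move=> /label_J_E; have /andP[/negPf -> /negPf ->] := valP z.
Qed.

(** The labels along the walk are forced.  Inner vertices of distinct copies of
    [J] are not adjacent, so [w1] to [w5] lie in one copy; there, of the two
    terminals, [S1] is adjacent to [a] alone and [S5] to [b] alone. *)
Lemma typed_walk_arc u v (w1 w2 w3 w4 w5 : replacement K J) :
  adj (inl u : replacement K J) w1 -> is_A (fold_label w1) ->
  adj w1 w2 -> is_A (fold_label w2) ->
  adj w2 w3 -> is_B (fold_label w3) -> adj w3 w4 -> is_B (fold_label w4) ->
  adj w4 w5 -> is_A (fold_label w5) -> adj w5 (inl v) -> Defs.arc u v.
Proof.
move=> a01 A1 a12 A2 a23 B3 a34 B4 a45 A5 a56.
have [] := @label_walk (fold_label (inl u)) (fold_label w1) (fold_label w2)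
  (fold_label w3) (fold_label w4) (fold_label w5) (fold_label (inl v));
  rewrite ?fold_label_hom //.
move=> l1 l2 l3 l4 l5.
have inner w : ~~ is_E (fold_label w) -> exists e z, w = inr (e, z).
  by case: w => [//|[e z] _]; exists e, z.
have [e1 [z1 w1E]] : exists e z, w1 = inr (e, z) by apply: inner; rewrite l1.
have [e2 [z2 w2E]] : exists e z, w2 = inr (e, z) by apply: inner; rewrite l2.
have [e3 [z3 w3E]] : exists e z, w3 = inr (e, z) by apply: inner; rewrite l3.
have [e4 [z4 w4E]] : exists e z, w4 = inr (e, z) by apply: inner; rewrite l4.
have [e5 [z5 w5E]] : exists e z, w5 = inr (e, z) by apply: inner; rewrite l5.
subst w1 w2 w3 w4 w5.
have e15 : e1 = e5.
  rewrite (repl_adj_copy a12) (repl_adj_copy a23) (repl_adj_copy a34).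
  exact: repl_adj_copy a45.
have := repl_adj_base a01; rewrite (label_J_S1 l1) => -[[_ ->]|[]] //.
rewrite adj_sym in a56.
have := repl_adj_base a56; rewrite (label_J_S5 l5) => -[[]|[_ ->]] //.
rewrite -e15; exact: (valP e1).
Qed.

End TypedWalk.

(** * Roots are sent to roots of the same type *)

Section Rigidity.
Local Open Scope ring_scope.
Variables (R : realType) (n : nat) (X : sgraph) (K : digraph).
Let Y := replacement K J.
Variable E : X -> Y -> 'M[R[i]]_n.
Hypothesis qE : quantum_hom E.

Definition on_label (Q : pred label) : pred Y := fun w => Q (fold_label w).

Lemma confined_A x : hangs A_gadget (@adj X) x -> confined E x (on_label is_A).
Proof.
move=> [c [chom chook]] w wA.
apply: (wheel_hub_vanish qE (c := c)
  (side := fun z => side (fold_label w) (fold_label z))).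
- by move=> i; apply: chook.
- by move=> i; apply: chom; rewrite /= /cycle_adj eqxx.
- move=> z z' /fold_label_hom wz /fold_label_hom wz' /fold_label_hom.
  exact: label_bip.
Qed.

Lemma confined_B x : hangs B_gadget (@adj X) x -> confined E x (on_label is_B).
Proof.
move=> [c [chom chook]] w wB.
have rootA j : confined E (c (inl j)) (on_label is_A).
  apply: confined_A; apply: (hangs_hom chom).
  exact: (@hangs_attach (complete 2) (fun=> A_gadget)).
apply: (edge_roots_vanish qE _ _ _ (rootA ord0) (rootA ord_max)).
- exact: chook.
- exact: chook.
- exact: chom.
- move=> z z' /fold_label_hom wz /fold_label_hom wz' Az Az'.
  apply/negP => /fold_label_hom; apply/negP.
  by apply: label_A_indep wz wz' Az Az'.
Qed.

Lemma confined_E x : hangs E_gadget (@adj X) x -> confined E x (on_label is_E).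
Proof.
move=> [c [chom chook]] w wE.
have rootB j : confined E (c (inl j)) (on_label is_B).
  apply: confined_B; apply: (hangs_hom chom).
  exact: (@hangs_attach (complete 2) (fun=> B_gadget)).
apply: (edge_roots_vanish qE _ _ _ (rootB ord0) (rootB ord_max)).
- exact: chook.
- exact: chook.
- exact: chom.
- move=> z z' /fold_label_hom wz /fold_label_hom wz' Bz Bz'.
  apply/negP => /fold_label_hom; apply/negP.
  by apply: label_B_indep wz wz' Bz Bz'.
Qed.

End Rigidity.

Section Bases.
Local Open Scope ring_scope.
Variables (R : realType) (n : nat) (H K : digraph).
Variable E : replacement H J -> replacement K J -> 'M[R[i]]_n.
Hypothesis qE : quantum_hom E.

Lemma hangs_spine (e : arcs H) (i : 'I_7) :
  hangs (J_gadget i) (@adj (replacement H J)) (repl_copy e (J_spine i : J)).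
Proof.
apply: hangs_hom (repl_copy_hom e) _; exact: hangs_attach.
Qed.

Lemma base_confined (e : arcs H) :
  confined E (inl (val e).1) (on_label is_E).
Proof.
apply: (confined_E qE); rewrite -(@repl_copy_a H J).
exact: (hangs_spine e ord0).
Qed.

(** Expanding the product along the spine of the copy of [J] at [e] leaves only
    terms indexed by walks of the type of the spine, which end on an arc. *)
Lemma base_orth (e : arcs H) y y' : ~~ Defs.arc y y' ->
  E (inl (val e).1) (inl y) *m E (inl (val e).2) (inl y') = 0.
Proof.
move=> nyy'.
pose s i (i7 : (i < 7)%N) : replacement H J := @repl_copy H J e (spine i7).
have s0 : s 0 isT = inl (val e).1.
  by rewrite -(@repl_copy_a H J); congr repl_copy; congr inl; apply: val_inj.
have s6 : s 6 isT = inl (val e).2.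
  by rewrite -(@repl_copy_b H J); congr repl_copy; congr inl; apply: val_inj.
rewrite -s0 -s6.
have step i (i7 : (i < 7)%N) (j7 : (i.+1 < 7)%N) : adj (s i i7) (s i.+1 j7).
  by apply: repl_copy_hom; apply/orP; left.
have h i i7 := hangs_spine e (@Ordinal 7 i i7).
apply: (walk_step qE (step 0 isT isT) (confined_A qE (h 1 isT))) => w1 a01 A1.
apply: (walk_step qE (step 1 isT isT) (confined_A qE (h 2 isT))) => w2 a12 A2.
apply: (walk_step qE (step 2 isT isT) (confined_B qE (h 3 isT))) => w3 a23 B3.
apply: (walk_step qE (step 3 isT isT) (confined_B qE (h 4 isT))) => w4 a34 B4.
apply: (walk_step qE (step 4 isT isT) (confined_A qE (h 5 isT))) => w5 a45 A5.
have [_ _ _ Ea] := qE; apply: Ea; first exact: (step 5 isT isT).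
apply: contra nyy' => a56.
exact: (typed_walk_arc a01 A1 a12 A2 a23 B3 a34 B4 a45 A5 a56).
Qed.

End Bases.

(** * Directed cycles *)

Section Cycles.
Local Open Scope ring_scope.
Variable R : realType.

Lemma dcycle_qhom_dvd n m : (1 < n)%N -> (1 < m)%N ->
  qhom R (replacement (dcycle n) J) (replacement (dcycle m) J) -> (m %| n)%N.
Proof.
move=> n1 m1 [d [E [d0 qE]]]; have [_ Esum Eorth _] := qE.
have arcP (u : 'Z_n) : Defs.arc (u : dcycle n) (u + 1) by apply: eqxx.
pose e (u : 'Z_n) : arcs (dcycle n) := Sub (u, u + 1) (arcP u).
pose F (u : 'Z_n) (y : 'Z_m) := E (inl u) (inl y).
have avoid u := base_confined qE (e u).
have Fsum u : \sum_y F u y = 1%:M.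
  rewrite -(Esum (inl u)) big_sumType /= [X in _ + X]big1 ?addr0 // => z _.
  by apply: avoid; apply/negP => /fold_label_E[].
have Fs u y y' : y' != y + 1 -> F u y *m F (u + 1) y' = 0.
  by move=> ne; apply: (base_orth qE (e u)).
(* Both sides are equal to the product of the two: the successor is unique, and
   so is the predecessor. *)
have step u y : F u y = F (u + 1) (y + 1).
  transitivity (F u y *m F (u + 1) (y + 1)).
    rewrite -[LHS]mulmx1 -(Fsum (u + 1)) mulmx_sumr (bigD1 (y + 1)) //=.
    by rewrite big1 ?addr0 // => y'; apply: Fs.
  rewrite -[RHS]mul1mx -(Fsum u) mulmx_suml (bigD1 y) //= big1 ?addr0 //.
  move=> y' ne; apply: Fs; apply: contra ne => /eqP.
  by move=> /addIr ->.
have steps k u y : F u y = F (u + k%:R) (y + k%:R).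
  elim: k => [|k IH]; first by rewrite !addr0.
  by rewrite IH step -!addrA !natr1.
apply: contraT => ndvd.
have n0 : n%:R != 0 :> 'Z_m.
  apply: contra ndvd => /eqP e0; have := val_Zp_nat m1 n; rewrite e0 /= => em.
  by rewrite /dvdn -em.
have F0 y : F 0 y = 0.
  have [Ep _ _ _] := qE.
  rewrite -[LHS](Ep _ _).1 -/(F 0 y) {2}(steps n) (pchar_Zp n1) addr0.
  apply: Eorth; apply: contra n0 => /eqP[] /eqP.
  by rewrite -subr_eq0 opprD addNKr oppr_eq0.
have := Fsum 0; rewrite big1 // => /matrixP/(_ (Ordinal d0) (Ordinal d0)).
by rewrite !mxE eqxx => /eqP; rewrite eq_sym oner_eq0.
Qed.

Lemma dvd_dcycle_qhom n m : (1 < n)%N -> (1 < m)%N -> (m %| n)%N ->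
  qhom R (replacement (dcycle n) J) (replacement (dcycle m) J).
Proof.
move=> n1 m1 mn.
pose f (u : dcycle n) : dcycle m := ((u : 'Z_n) : nat)%:R.
have farc (u v : dcycle n) : Defs.arc u v -> Defs.arc (f u) (f v).
  move=> /eqP ->; apply/eqP; rewrite /f -[u in LHS]natr_Zp natr1 val_Zp_nat //.
  by rewrite -[LHS](Zp_nat_mod m1) modn_dvdm // Zp_nat_mod // natr1.
by have [F Fhom] := replacement_hom J farc; apply: hom_qhom Fhom.
Qed.

Lemma dcycle_qhomP n m : (1 < n)%N -> (1 < m)%N ->
  qhom R (replacement (dcycle n) J) (replacement (dcycle m) J) <-> (m %| n)%N.
Proof.
by move=> n1 m1; split; [apply: dcycle_qhom_dvd | apply: dvd_dcycle_qhom].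
Qed.

End Cycles.

(** * Encoding a finite order by divisibility *)

Section Primes.

Fixpoint prime_seq (k : nat) : nat :=
  if k is k'.+1 then s2val (prime_above (prime_seq k')) else 2.

Lemma prime_seq_prime k : prime (prime_seq k).
Proof. by case: k => //= k; case: prime_above. Qed.

Lemma prime_seq_lt k : prime_seq k < prime_seq k.+1.
Proof. by rewrite /=; case: prime_above. Qed.

Lemma prime_seq_inj : injective prime_seq.
Proof. exact/incn_inj/leq_mono/(homo_ltn ltn_trans)/prime_seq_lt. Qed.

Variables (disp : Order.disp_t) (P : finPOrderType disp) (prm : P -> nat).
Hypotheses (prm_inj : injective prm) (prmP : forall r, prime (prm r)).

Definition upper_prod (p : P) : nat := \prod_(r : P | (p <= r)%O) prm r.

Lemma prm_dvd_upper_prod p q : (prm q %| upper_prod p) = (p <= q)%O.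
Proof.
apply/idP/idP => [|pq]; last by rewrite /upper_prod (bigD1 q) //= dvdn_mulr.
rewrite Euclid_dvd_prod // big_has_cond => /hasP[r _ /andP[pr]].
by rewrite dvdn_prime2 // => /eqP/prm_inj ->.
Qed.

Lemma upper_prod_gt1 p : 1 < upper_prod p.
Proof.
apply: leq_trans (prime_gt1 (prmP p)) (dvdn_leq _ _).
  by apply: prodn_cond_gt0 => r _; apply: prime_gt0.
by rewrite prm_dvd_upper_prod.
Qed.

Lemma upper_prod_dvd p q : (upper_prod q %| upper_prod p) = (p <= q)%O.
Proof.
apply/idP/idP => [qp|pq].
  rewrite -prm_dvd_upper_prod; apply: dvdn_trans qp.
  by rewrite prm_dvd_upper_prod.
rewrite /upper_prod [X in _ %| X](bigID (fun r => q <= r)%O) /=.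
rewrite [X in _ %| X * _](eq_bigl (fun r => q <= r)%O) ?dvdn_mulr // => r.
by apply: andb_idl; apply: le_trans.
Qed.

End Primes.

(** * The representation theorem *)

Theorem corollary5p4 (R : realType) :
  (forall (disp : Order.disp_t) (P : finPOrderType disp),
    (exists G : P -> sgraph, forall p q : P, (p <= q)%O <-> qhom R (G p) (G q))
    /\
    (forall prm : P -> nat, injective prm -> (forall r, prime (prm r)) ->
      let N (p : P) := (\prod_(r : P | (p <= r)%O) prm r)%N in
      let G (p : P) := replacement (dcycle (N p)) J in
      forall p q : P, (p <= q)%O <-> qhom R (G p) (G q)))
  /\
  [/\ (forall n : nat, exists c : 'I_n -> qclass R,
        forall i j : 'I_n, i != j -> ~ qle (c i) (c j)),
      (forall n : nat, exists c : 'I_n -> qclass R,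
        forall i j : 'I_n, (i < j)%N -> qlt (c i) (c j))
    & (forall (disp : Order.disp_t) (P : finPOrderType disp),
        exists f : P -> qclass R, forall p q : P, (p <= q)%O <-> qle (f p) (f q))].
Proof.
have explicit disp (P : finPOrderType disp) (prm : P -> nat) :
    injective prm -> (forall r, prime (prm r)) ->
    forall p q, (p <= q)%O <->
      qhom R (replacement (dcycle (upper_prod prm p)) J)
             (replacement (dcycle (upper_prod prm q)) J).
  move=> inj pr p q; rewrite -(upper_prod_dvd inj pr).
  by apply: iff_sym; apply: dcycle_qhomP; apply: upper_prod_gt1.
have embed disp (P : finPOrderType disp) :
    exists G : P -> sgraph, forall p q : P, (p <= q)%O <-> qhom R (G p) (G q).
  pose prm (r : P) := prime_seq (enum_rank r).
  have prm_inj : injective prm.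
    by move=> r s /prime_seq_inj/val_inj/enum_rank_inj.
  eexists=> p q; apply: (explicit _ _ prm) => // r; exact: prime_seq_prime.
split; first by move=> disp P; split=> // prm; apply: explicit.
split.
- move=> n; exists (fun i => qclass_of R (replacement (dcycle (prime_seq i)) J)).
  move=> i j ij /qle_class /dcycle_qhomP.
  rewrite !prime_gt1 ?prime_seq_prime // => /(_ isT isT).
  rewrite dvdn_prime2 ?prime_seq_prime // => /eqP/prime_seq_inj/val_inj ji.
  by rewrite ji eqxx in ij.
- (* The exponents decrease because the order reverses divisibility; they are
     positive since [i < n]. *)
  move=> n; exists (fun i => qclass_of R (replacement (dcycle (2 ^ (n - i))) J)).
  have gt1 (i : 'I_n) : 1 < 2 ^ (n - i).
    by rewrite -{1}(expn0 2) ltn_exp2l // subn_gt0.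
  move=> i j ij; split.
    apply/qle_class; apply: dvd_dcycle_qhom (gt1 i) (gt1 j) _.
    by apply: dvdn_exp2l; apply: leq_sub2l; apply: ltnW.
  move=> /qclass_ofP[_ /(dcycle_qhom_dvd (gt1 j) (gt1 i))].
  by rewrite dvdn_Pexp2l // leqNgt ltn_sub2l // (leq_ltn_trans _ (ltn_ord j)).
- move=> disp P; have [G GP] := embed disp P.
  exists (fun p => qclass_of R (G p)) => p q.
  by rewrite GP; apply: iff_sym; apply: qle_class.
Qed.
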